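(* Let $\mathscr{D}$ be a preduoidal category with monoidal structures $(\circ,\bot)$ and $(\bullet,1)$, and let $T$ be a separately opmonoidal monad on $\mathscr{D}$. A quasitriangular structure $(R,\nu,\varpi,\iota)$ on $T$ yields, for all $T$-algebras $(a,\alpha),(b,\beta),(c,\gamma),(d,\delta)$, an interchange law $$\xi_{a,b,c,d}:=\big((\alpha\circ\gamma)\bullet(\beta\circ\delta)\big)\cdot R_{a,b,c,d}\colon(a\bullet b)\circ(c\bullet d)\to(a\circ c)\bullet(b\circ d)$$ making $(\mathscr{D}^T,\circ,\bot,\bullet,1)$ with $\nu,\varpi,\iota$ a duoidal category. Conversely, an interchange law $\xi$ of a duoidal structure on $\mathscr{D}^T$ (with respect to these two monoidal structures) gives rise to an R-matrix $$R_{a,b,c,d}:=\xi_{Ta,Tb,Tc,Td}\cdot\big((\eta_a\bullet\eta_b)\circ(\eta_c\bullet\eta_d)\big)\colon(a\bullet b)\circ(c\bullet d)\to(Ta\circ Tc)\bullet(Tb\circ Td)$$ on $T$ (with the same $\nu,\varpi,\iota$). These constructions are mutually inverse; thus quasitriangular structures on $T$ are in bijection with duoidal structures on $\mathscr{D}^T$.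
   Context: Composition of morphisms is written $\cdot$ (or juxtaposition); associators and unitors are suppressed or denoted by $\cong$. Duoidal category: a category $\mathscr{D}$ with monoidal structures $(\circ,\bot)$, $(\bullet,1)$, a natural transformation (interchange law) $\zeta\colon(x\bullet y)\circ(a\bullet b)\to(x\circ a)\bullet(y\circ b)$ and morphisms $\nu\colon\bot\to\bot\bullet\bot$, $\varpi\colon1\circ1\to1$, $\iota\colon\bot\to1$ such that $(1,\varpi,\iota)$ is a monoid in $(\mathscr{D},\circ,\bot)$, $(\bot,\nu,\iota)$ is a comonoid in $(\mathscr{D},\bullet,1)$, $\zeta$ is associative (the two composites $(x\bullet y)\circ(a\bullet b)\circ(c\bullet d)\to(x\circ a\circ c)\bullet(y\circ b\circ d)$ agree, and the two composites $(x\bullet a\bullet c)\circ(y\bullet b\bullet d)\to(x\circ y)\bullet(a\circ b)\bullet(c\circ d)$ agree), and unital: $\bot\circ(a\bullet b)\xrightarrow{\nu\circ\mathrm{id}}(\bot\bullet\bot)\circ(a\bullet b)\xrightarrow{\zeta}(\bot\circ a)\bullet(\bot\circ b)$ equals the composite of unitors through $a\bullet b$, similarly for $(a\bullet b)\circ\bot$; and $(1\bullet a)\circ(1\bullet b)\xrightarrow{\zeta}(1\circ1)\bullet(a\circ b)\xrightarrow{\varpi\bullet\mathrm{id}}1\bullet(a\circ b)$ equals the composite of unitors through $a\circ b$, similarly for $(a\bullet1)\circ(b\bullet1)$. A preduoidal category is a category with two monoidal structures $(\circ,\bot)$ and $(\bullet,1)$. A separately opmonoidal monad $T$ on it is a monad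 $(T,\mu,\eta)$ with bimonad structures with respect to both: oplax monoidal structures $T^\circ_2\colon T(x\circ y)\to Tx\circ Ty$, $T^\circ_0\colon T\bot\to\bot$ and $T^\bullet_2\colon T(x\bullet y)\to Tx\bullet Ty$, $T^\bullet_0\colon T1\to1$ such that $\mu,\eta$ are oplax monoidal for both. Then $\mathscr{D}^T$ (Eilenberg–Moore category) inherits both monoidal structures, with units $(\bot,T^\circ_0)$, $(1,T^\bullet_0)$ and e.g. $(a,\alpha)\circ(b,\beta)=(a\circ b,(\alpha\circ\beta)T^\circ_2)$. A duoidal structure on $\mathscr{D}^T$ is understood with respect to these two monoidal structures. An R-matrix (quasitriangular structure) on $T$ consists of a natural transformation $R_{a,b,c,d}\colon(a\bullet b)\circ(c\bullet d)\to(Ta\circ Tc)\bullet(Tb\circ Td)$ and morphisms of $T$-algebras $\nu\colon\bot\to\bot\bullet\bot$, $\varpi\colon1\circ1\to1$, $\iota\colon\bot\to1$ such that $(1,\varpi,\iota)$ is a monoid in $(\mathscr{D}^T,\circ,\bot)$, $(\bot,\nu,\iota)$ is a comonoid in $(\mathscr{D}^T,\bullet,1)$, and for all objects $a,b,c,d,x,y\in\mathscr{D}$: (1) $\big((T_0^\circ\circ Ta)\bullet(T_0^\circ\circ Tb)\big)R_{\bot,\bot,a,b}(\nu\circ\mathrm{id}_{a\bullet b})$ equals $\bot\circ(a\bullet b)\cong a\bullet b\xrightarrow{\eta_a\bullet\eta_b}Ta\bullet Tb\cong(\bot\circ Ta)\bullet(\bot\circ Tb)$, and symmetrically $\big((Ta\circ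 T_0^\circ)\bullet(Tb\circ T_0^\circ)\big)R_{a,b,\bot,\bot}(\mathrm{id}_{a\bullet b}\circ\nu)$ equals $(a\bullet b)\circ\bot\cong a\bullet b\xrightarrow{\eta_a\bullet\eta_b}Ta\bullet Tb\cong(Ta\circ\bot)\bullet(Tb\circ\bot)$; (2) $\big(\varpi(T_0^\bullet\circ T_0^\bullet)\bullet\mathrm{id}\big)R_{1,a,1,b}$ equals $(1\bullet a)\circ(1\bullet b)\cong a\circ b\xrightarrow{\eta_a\circ\eta_b}Ta\circ Tb\cong1\bullet(Ta\circ Tb)$, and symmetrically $\big(\mathrm{id}\bullet\varpi(T_0^\bullet\circ T_0^\bullet)\big)R_{a,1,b,1}$ equals $(a\bullet1)\circ(b\bullet1)\cong a\circ b\xrightarrow{\eta_a\circ\eta_b}Ta\circ Tb\cong(Ta\circ Tb)\bullet1$; (3) $\big((\mu_a\circ\mu_c)\bullet(\mu_b\circ\mu_d)\big)R_{Ta,Tb,Tc,Td}\,(T^\bullet_{2;a,b}\circ T^\bullet_{2;c,d})\,T^\circ_{2;a\bullet b,c\bullet d}=\big((\mu_a\circ\mu_c)\bullet(\mu_b\circ\mu_d)\big)(T^\circ_{2;Ta,Tc}\bullet T^\circ_{2;Tb,Td})\,T^\bullet_{2;Ta\circ Tc,Tb\circ Td}\,T(R_{a,b,c,d})$; (4) $\big((\mu_a\circ\mu_c\circ Tx)\bullet(\mu_b\circ\mu_d\circ Ty)\big)\big((T^\circ_{2;Ta,Tc}\circ Tx)\bullet(T^\circ_{2;Tb,Td}\circ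 Ty)\big)R_{Ta\circ Tc,Tb\circ Td,x,y}(R_{a,b,c,d}\circ\mathrm{id}_{x\bullet y})=\big((Ta\circ\mu_c\circ\mu_x)\bullet(Tb\circ\mu_d\circ\mu_y)\big)\big((Ta\circ T^\circ_{2;Tc,Tx})\bullet(Tb\circ T^\circ_{2;Td,Ty})\big)R_{a,b,Tc\circ Tx,Td\circ Ty}(\mathrm{id}_{a\bullet b}\circ R_{c,d,x,y})$; (5) $\big((\mu_x\circ\mu_y)\bullet(\mu_a\circ\mu_b)\bullet\mathrm{id}\big)(R_{Tx,Ta,Ty,Tb}\bullet\mathrm{id})\big((T^\bullet_{2;x,a}\circ T^\bullet_{2;y,b})\bullet\mathrm{id}_{Tc\circ Td}\big)R_{x\bullet a,c,y\bullet b,d}=\big(\mathrm{id}\bullet(\mu_a\circ\mu_b)\bullet(\mu_c\circ\mu_d)\big)(\mathrm{id}\bullet R_{Ta,Tc,Tb,Td})\big(\mathrm{id}_{Tx\circ Ty}\bullet(T^\bullet_{2;a,c}\circ T^\bullet_{2;b,d})\big)R_{x,a\bullet c,y,b\bullet d}$. *)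

(* Defs.v *)
(* Morphisms of a category are compared by Leibniz equality; proof irrelevance
   is what makes morphisms of Eilenberg-Moore algebras equal as soon as the
   underlying morphisms are. *)
From mathcomp Require Import ssreflect ssrfun.
From Stdlib Require Import ProofIrrelevance.

Set Implicit Arguments.
Unset Strict Implicit.
Unset Printing Implicit Defensive.

(* The symbols of the two tensor products denote their action on objects in
   [ob_scope] and on morphisms in [mor_scope]. *)
Declare Scope ob_scope.
Declare Scope mor_scope.
Delimit Scope ob_scope with ob.
Delimit Scope mor_scope with mor.

Reserved Notation "g · f" (at level 40, left associativity).
Reserved Notation "a ⊗ b" (at level 35, right associativity).
Reserved Notation "a ∘ b" (at level 35, right associativity).
Reserved Notation "a • b" (at level 35, right associativity).

Record category := Category {
  obj :> Type;
  hom : obj -> obj -> Type;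
  idm : forall a, hom a a;
  comp : forall a b c, hom b c -> hom a b -> hom a c;
  comp1m : forall a b (f : hom a b), comp (idm b) f = f;
  compm1 : forall a b (f : hom a b), comp f (idm a) = f;
  compA : forall a b c d (h : hom c d) (g : hom b c) (f : hom a b),
    comp h (comp g f) = comp (comp h g) f
}.

Bind Scope ob_scope with obj.
Bind Scope mor_scope with hom.
Arguments hom {_} (_ _)%_ob.
Arguments idm {_} _%_ob.
Arguments comp {_} {_ _ _}%_ob (_ _)%_mor.

Notation "g · f" := (comp g f) : mor_scope.
Open Scope mor_scope.

Record functor (C D : category) := Functor {
  fobj :> C -> D;
  fmor : forall a b : C, hom a b -> hom (fobj a) (fobj b);
  fmor1 : forall a, fmor (idm a) = idm (fobj a);
  fmorM : forall a b c (g : hom b c) (f : hom a b),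
    fmor (g · f) = fmor g · fmor f
}.
Arguments fmor {C D} _ {a b} _%_mor.

Record monad (C : category) := Monad {
  mfun :> functor C C;
  mu : forall a, hom (mfun (mfun a)) (mfun a);
  eta : forall a, hom a (mfun a);
  mu_nat : forall a b (f : hom a b),
    mu b · fmor mfun (fmor mfun f) = fmor mfun f · mu a;
  eta_nat : forall a b (f : hom a b), eta b · f = fmor mfun f · eta a;
  mu_mu : forall a, mu a · fmor mfun (mu a) = mu a · mu (mfun a);
  mu_eta : forall a, mu a · eta (mfun a) = idm (mfun a);
  mu_Teta : forall a, mu a · fmor mfun (eta a) = idm (mfun a)
}.
Arguments mu {C} _ _%_ob.
Arguments eta {C} _ _%_ob.

Record algebra (C : category) (T : monad C) := Algebra {
  carrier : C;
  act : hom (T carrier) carrier;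
  act_eta : act · eta T carrier = idm carrier;
  act_mu : act · mu T carrier = act · fmor T act
}.

Record alg_hom (C : category) (T : monad C) (A B : algebra T) := AlgHom {
  alg_mor : hom (carrier A) (carrier B);
  alg_morP : alg_mor · act A = act B · fmor T alg_mor
}.

Lemma alg_hom_eq (C : category) (T : monad C) (A B : algebra T)
  (f g : alg_hom A B) : alg_mor f = alg_mor g -> f = g.
Proof.
case: f g => [f pf] [g pg] /= e; rewrite -e in pg *.
by rewrite (proof_irrelevance _ pf pg).
Qed.

Section EilenbergMoore.
Variables (C : category) (T : monad C).

Lemma alg_idP (A : algebra T) :
  idm (carrier A) · act A = act A · fmor T (idm (carrier A)).
Proof. by rewrite fmor1 comp1m compm1. Qed.

Lemma alg_compP (A B D : algebra T) (g : alg_hom B D) (f : alg_hom A B) :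
  (alg_mor g · alg_mor f) · act A = act D · fmor T (alg_mor g · alg_mor f).
Proof. by rewrite fmorM compA -alg_morP -!compA alg_morP. Qed.

Definition alg_id (A : algebra T) : alg_hom A A := AlgHom (alg_idP A).
Definition alg_comp (A B D : algebra T) (g : alg_hom B D) (f : alg_hom A B) :
  alg_hom A D := AlgHom (alg_compP g f).

Definition em_category : category.
Proof.
refine (@Category (algebra T) (@alg_hom C T) alg_id alg_comp _ _ _).
- by move=> A B f; apply: alg_hom_eq; rewrite /= comp1m.
- by move=> A B f; apply: alg_hom_eq; rewrite /= compm1.
- by move=> A B D E h g f; apply: alg_hom_eq; rewrite /= compA.
Defined.

Definition free_algebra (a : C) : algebra T :=
  @Algebra C T (T a) (mu T a) (mu_eta T a) (esym (mu_mu T a)).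

End EilenbergMoore.

Record monoidal (C : category) := Monoidal {
  tob : C -> C -> C;
  tmor : forall a b c d : C,
    hom a b -> hom c d -> hom (tob a c) (tob b d);
  tunit : C;
  assoc : forall a b c, hom (tob (tob a b) c) (tob a (tob b c));
  assocV : forall a b c, hom (tob a (tob b c)) (tob (tob a b) c);
  lun : forall a, hom (tob tunit a) a;
  lunV : forall a, hom a (tob tunit a);
  run : forall a, hom (tob a tunit) a;
  runV : forall a, hom a (tob a tunit);
  tmor1 : forall a b, tmor (idm a) (idm b) = idm (tob a b);
  tmorM : forall a b c a' b' c' (g : hom b c) (f : hom a b)
      (g' : hom b' c') (f' : hom a' b'),
    tmor (g · f) (g' · f') = tmor g g' · tmor f f';
  assoc_nat : forall a b c a' b' c' (f : hom a a') (g : hom b b') (h : hom c c'),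
    assoc a' b' c' · tmor (tmor f g) h = tmor f (tmor g h) · assoc a b c;
  lun_nat : forall a b (f : hom a b), lun b · tmor (idm tunit) f = f · lun a;
  run_nat : forall a b (f : hom a b), run b · tmor f (idm tunit) = f · run a;
  assocK : forall a b c, assocV a b c · assoc a b c = idm _;
  assocVK : forall a b c, assoc a b c · assocV a b c = idm _;
  lunK : forall a, lunV a · lun a = idm _;
  lunVK : forall a, lun a · lunV a = idm _;
  runK : forall a, runV a · run a = idm _;
  runVK : forall a, run a · runV a = idm _;
  pentagon : forall a b c d,
    assoc a b (tob c d) · assoc (tob a b) c d
    = tmor (idm a) (assoc b c d) · assoc a (tob b c) d
      · tmor (assoc a b c) (idm d);
  triangle : forall a b,
    tmor (idm a) (lun b) · assoc a tunit b = tmor (run a) (idm b)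
}.
Arguments tob {C} _ (_ _)%_ob.
Arguments tmor {C} _ {a b c d} (_ _)%_mor.
Arguments assoc {C} _ (a b c)%_ob.
Arguments assocV {C} _ (a b c)%_ob.
Arguments lun {C} _ a%_ob.
Arguments lunV {C} _ a%_ob.
Arguments run {C} _ a%_ob.
Arguments runV {C} _ a%_ob.

Section MonoidalNotions.
Variables (C : category) (M : monoidal C).
Local Notation "a ⊗ b" := (tob M a b) : ob_scope.
Local Notation "f ⊗ g" := (tmor M f g) : mor_scope.
Local Notation I := (tunit M).

Record is_monoid (m : C) (mult : hom (m ⊗ m) m) (one : hom I m) : Prop :=
  IsMonoid {
  monoidA : mult · (mult ⊗ idm m) = mult · (idm m ⊗ mult) · assoc M m m m;
  monoid1m : mult · (one ⊗ idm m) = lun M m;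
  monoidm1 : mult · (idm m ⊗ one) = run M m
}.

Record is_comonoid (c : C) (comult : hom c (c ⊗ c)) (counit : hom c I) : Prop :=
  IsComonoid {
  comonoidA :
    assoc M c c c · (comult ⊗ idm c) · comult = (idm c ⊗ comult) · comult;
  comonoid1m : lun M c · (counit ⊗ idm c) · comult = idm c;
  comonoidm1 : run M c · (idm c ⊗ counit) · comult = idm c
}.

(* The last four axioms say that [mu] and [eta] are oplax monoidal natural
   transformations, the oplax structure of [T \o T] being
   [op2 (T a) (T b) · T (op2 a b)] and [op0 · T op0]. *)
Record opmonoidal (T : monad C) := Opmonoidal {
  op2 : forall a b, hom (T (a ⊗ b)%ob) (T a ⊗ T b);
  op0 : hom (T I) I;
  op2_nat : forall a b a' b' (f : hom a a') (g : hom b b'),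
    op2 a' b' · fmor T (f ⊗ g) = (fmor T f ⊗ fmor T g) · op2 a b;
  op2_assoc : forall a b c,
    assoc M (T a) (T b) (T c) · (op2 a b ⊗ idm (T c)) · op2 (a ⊗ b)%ob c
    = (idm (T a) ⊗ op2 b c) · op2 a (b ⊗ c)%ob · fmor T (assoc M a b c);
  op2_lun : forall a,
    lun M (T a) · (op0 ⊗ idm (T a)) · op2 I a = fmor T (lun M a);
  op2_run : forall a,
    run M (T a) · (idm (T a) ⊗ op0) · op2 a I = fmor T (run M a);
  op2_mu : forall a b,
    op2 a b · mu T (a ⊗ b)
    = (mu T a ⊗ mu T b) · (op2 (T a) (T b) · fmor T (op2 a b));
  op0_mu : op0 · mu T I = op0 · fmor T op0;
  op2_eta : forall a b, op2 a b · eta T (a ⊗ b) = eta T a ⊗ eta T b;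
  op0_eta : op0 · eta T I = idm I
}.

End MonoidalNotions.
Arguments op2 {C M T} _ (a b)%_ob.
Arguments op0 {C M T} _.

Section EMMonoidal.
Variables (C : category) (M : monoidal C) (T : monad C) (P : opmonoidal M T).
Local Notation "a ⊗ b" := (tob M a b) : ob_scope.
Local Notation "f ⊗ g" := (tmor M f g) : mor_scope.
Local Notation I := (tunit M).

Lemma em_tensor_eta (A B : algebra T) :
  (act A ⊗ act B) · op2 P (carrier A) (carrier B)
    · eta T (carrier A ⊗ carrier B) = idm (carrier A ⊗ carrier B).
Proof. by rewrite -compA op2_eta -tmorM !act_eta tmor1. Qed.

Lemma em_tensor_mu (A B : algebra T) :
  (act A ⊗ act B) · op2 P (carrier A) (carrier B) · mu T (carrier A ⊗ carrier B)
  = (act A ⊗ act B) · op2 P (carrier A) (carrier B)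
    · fmor T ((act A ⊗ act B) · op2 P (carrier A) (carrier B)).
Proof.
rewrite -compA op2_mu fmorM !compA -tmorM !act_mu.
by rewrite -[in RHS](compA (act A ⊗ act B)) op2_nat !compA -tmorM.
Qed.

Definition em_tensor (A B : algebra T) : algebra T :=
  Algebra (em_tensor_eta A B) (em_tensor_mu A B).

Definition em_unit : algebra T := Algebra (op0_eta P) (op0_mu P).

Lemma em_tmorP (A B A' B' : algebra T) (f : alg_hom A A') (g : alg_hom B B') :
  (alg_mor f ⊗ alg_mor g) · act (em_tensor A B)
  = act (em_tensor A' B') · fmor T (alg_mor f ⊗ alg_mor g).
Proof.
by rewrite /= compA -tmorM !alg_morP tmorM -!compA op2_nat.
Qed.

Definition em_tmor (A A' B B' : algebra T) (f : alg_hom A A') (g : alg_hom B B') :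
  alg_hom (em_tensor A B) (em_tensor A' B') :=
  @AlgHom C T (em_tensor A B) (em_tensor A' B') _ (em_tmorP f g).

Lemma em_assocP (A B D : algebra T) :
  assoc M (carrier A) (carrier B) (carrier D)
    · act (em_tensor (em_tensor A B) D)
  = act (em_tensor A (em_tensor B D))
    · fmor T (assoc M (carrier A) (carrier B) (carrier D)).
Proof.
rewrite /= -{1}(compm1 (act D)) -{2}(compm1 (act A)) !tmorM !compA assoc_nat.
by rewrite -!compA; congr (_ · _); rewrite !compA op2_assoc.
Qed.

Lemma em_lunP (A : algebra T) :
  lun M (carrier A) · act (em_tensor em_unit A)
  = act A · fmor T (lun M (carrier A)).
Proof.
rewrite /= -(op2_lun P) -{1}(comp1m (op0 P)) -{1}(compm1 (act A)) tmorM.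
by rewrite !compA lun_nat.
Qed.

Lemma em_runP (A : algebra T) :
  run M (carrier A) · act (em_tensor A em_unit)
  = act A · fmor T (run M (carrier A)).
Proof.
rewrite /= -(op2_run P) -{1}(comp1m (op0 P)) -{1}(compm1 (act A)) tmorM.
by rewrite !compA run_nat.
Qed.

Lemma alg_invP (A B : algebra T) (f : hom (carrier A) (carrier B))
  (g : hom (carrier B) (carrier A)) :
  g · f = idm _ -> f · g = idm _ -> f · act A = act B · fmor T f ->
  g · act B = act A · fmor T g.
Proof.
move=> gf fg fP; rewrite -(compm1 (g · act B)) -fmor1 -fg fmorM !compA.
by rewrite -(compA g) -fP !compA gf comp1m.
Qed.

Definition em_assoc A B D :
    alg_hom (em_tensor (em_tensor A B) D) (em_tensor A (em_tensor B D)) :=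
  @AlgHom C T (em_tensor (em_tensor A B) D) (em_tensor A (em_tensor B D))
    _ (em_assocP A B D).
Definition em_lun A : alg_hom (em_tensor em_unit A) A :=
  @AlgHom C T (em_tensor em_unit A) A _ (em_lunP A).
Definition em_run A : alg_hom (em_tensor A em_unit) A :=
  @AlgHom C T (em_tensor A em_unit) A _ (em_runP A).

Definition em_inv (A B : algebra T) (f : alg_hom A B)
    (g : hom (carrier B) (carrier A)) (gf : g · alg_mor f = idm _)
    (fg : alg_mor f · g = idm _) : alg_hom B A :=
  AlgHom (alg_invP gf fg (alg_morP f)).

Definition em_assocV A B D :
    alg_hom (em_tensor A (em_tensor B D)) (em_tensor (em_tensor A B) D) :=
  @em_inv _ _ (em_assoc A B D) _ (assocK M _ _ _) (assocVK M _ _ _).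
Definition em_lunV A : alg_hom A (em_tensor em_unit A) :=
  @em_inv _ _ (em_lun A) _ (lunK M _) (lunVK M _).
Definition em_runV A : alg_hom A (em_tensor A em_unit) :=
  @em_inv _ _ (em_run A) _ (runK M _) (runVK M _).

Definition em_monoidal : monoidal (em_category T).
Proof.
refine (@Monoidal (em_category T) em_tensor em_tmor em_unit em_assoc em_assocV
  em_lun em_lunV em_run em_runV _ _ _ _ _ _ _ _ _ _ _ _ _);
  move=> *; apply: alg_hom_eq => /=.
- exact: tmor1.
- exact: tmorM.
- exact: assoc_nat.
- exact: lun_nat.
- exact: run_nat.
- exact: assocK.
- exact: assocVK.
- exact: lunK.
- exact: lunVK.
- exact: runK.
- exact: runVK.
- exact: pentagon.
- exact: triangle.
Defined.

End EMMonoidal.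

Record preduoidal := Preduoidal {
  pd_cat :> category;
  circ : monoidal pd_cat;
  bullet : monoidal pd_cat
}.

Notation "a ∘ b" := (tob (circ _) a b) : ob_scope.
Notation "f ∘ g" := (tmor (circ _) f g) : mor_scope.
Notation "a • b" := (tob (bullet _) a b) : ob_scope.
Notation "f • g" := (tmor (bullet _) f g) : mor_scope.
Notation "⊥" := (tunit (circ _)) : ob_scope.
Notation "𝟙" := (tunit (bullet _)) : ob_scope.

Section Duoidal.
Variable D : preduoidal.

(* The monoidal structures are not assumed strict: both associativity axioms
   compare composites along the associators. *)
Record is_duoidal
    (zeta : forall x y a b : D, hom ((x • y) ∘ (a • b)) ((x ∘ a) • (y ∘ b)))
    (nu : @hom D ⊥ (⊥ • ⊥)) (varpi : @hom D (𝟙 ∘ 𝟙) 𝟙) (iota : @hom D ⊥ 𝟙)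
    : Prop := IsDuoidal {
  duo_monoid : is_monoid (M := circ D) varpi iota;
  duo_comonoid : is_comonoid (M := bullet D) nu iota;
  zeta_nat : forall (x y a b x' y' a' b' : D)
      (f : hom x x') (g : hom y y') (h : hom a a') (k : hom b b'),
    zeta x' y' a' b' · ((f • g) ∘ (h • k))
    = ((f ∘ h) • (g ∘ k)) · zeta x y a b;
  zeta_circA : forall x y a b c d : D,
    (assoc (circ D) x a c • assoc (circ D) y b d)
      · zeta (x ∘ a)%ob (y ∘ b)%ob c d · (zeta x y a b ∘ idm (c • d))
    = zeta x y (a ∘ c)%ob (b ∘ d)%ob · (idm (x • y) ∘ zeta a b c d)
      · assoc (circ D) (x • y) (a • b) (c • d);
  zeta_bulletA : forall x a c y b d : D,
    assoc (bullet D) (x ∘ y) (a ∘ b) (c ∘ d)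
      · (zeta x a y b • idm (c ∘ d)) · zeta (x • a)%ob c (y • b)%ob d
    = (idm (x ∘ y) • zeta a c b d) · zeta x (a • c)%ob y (b • d)%ob
      · (assoc (bullet D) x a c ∘ assoc (bullet D) y b d);
  zeta_botl : forall a b : D,
    zeta ⊥%ob ⊥%ob a b · (nu ∘ idm (a • b))
    = (lunV (circ D) a • lunV (circ D) b) · lun (circ D) (a • b);
  zeta_botr : forall a b : D,
    zeta a b ⊥%ob ⊥%ob · (idm (a • b) ∘ nu)
    = (runV (circ D) a • runV (circ D) b) · run (circ D) (a • b);
  zeta_onel : forall a b : D,
    (varpi • idm (a ∘ b)) · zeta 𝟙%ob a 𝟙%ob b
    = lunV (bullet D) (a ∘ b) · (lun (bullet D) a ∘ lun (bullet D) b);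
  zeta_oner : forall a b : D,
    (idm (a ∘ b) • varpi) · zeta a 𝟙%ob b 𝟙%ob
    = runV (bullet D) (a ∘ b) · (run (bullet D) a ∘ run (bullet D) b)
}.

Record duoidal := Duoidal {
  duo_zeta : forall x y a b : D, hom ((x • y) ∘ (a • b)) ((x ∘ a) • (y ∘ b));
  duo_nu : @hom D ⊥ (⊥ • ⊥);
  duo_varpi : @hom D (𝟙 ∘ 𝟙) 𝟙;
  duo_iota : @hom D ⊥ 𝟙;
  duoP : is_duoidal duo_zeta duo_nu duo_varpi duo_iota
}.

Record sep_opmonoidal_monad := SepOpmonoidalMonad {
  som_monad :> monad D;
  som_circ : opmonoidal (circ D) som_monad;
  som_bullet : opmonoidal (bullet D) som_monad
}.

Variable T : sep_opmonoidal_monad.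

Definition EM : preduoidal :=
  Preduoidal (em_monoidal (som_circ T)) (em_monoidal (som_bullet T)).

Local Notation Tc2 := (op2 (som_circ T)).
Local Notation Tc0 := (op0 (som_circ T)).
Local Notation Tb2 := (op2 (som_bullet T)).
Local Notation Tb0 := (op0 (som_bullet T)).

(* [nu], [varpi] and [iota] are morphisms of T-algebras; [nuD] and [varpiD] are
   the morphisms of [D] underlying the first two. *)
Record is_R_matrix
    (R : forall a b c d : D, hom ((a • b) ∘ (c • d)) ((T a ∘ T c) • (T b ∘ T d)))
    (nu : @hom EM ⊥ (⊥ • ⊥)) (varpi : @hom EM (𝟙 ∘ 𝟙) 𝟙) (iota : @hom EM ⊥ 𝟙)
    (nuD : @hom D ⊥ (⊥ • ⊥) := alg_mor nu)
    (varpiD : @hom D (𝟙 ∘ 𝟙) 𝟙 := alg_mor varpi)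
    : Prop := IsRMatrix {
  R_monoid : is_monoid (M := circ EM) varpi iota;
  R_comonoid : is_comonoid (M := bullet EM) nu iota;
  R_nat : forall (a b c d a' b' c' d' : D)
      (f : hom a a') (g : hom b b') (h : hom c c') (k : hom d d'),
    R a' b' c' d' · ((f • g) ∘ (h • k))
    = ((fmor T f ∘ fmor T h) • (fmor T g ∘ fmor T k)) · R a b c d;
  R_botl : forall a b : D,
    ((Tc0 ∘ idm (T a)) • (Tc0 ∘ idm (T b)))
      · R ⊥%ob ⊥%ob a b · (nuD ∘ idm (a • b))
    = (lunV (circ D) (T a) • lunV (circ D) (T b))
      · (eta T a • eta T b) · lun (circ D) (a • b);
  R_botr : forall a b : D,
    ((idm (T a) ∘ Tc0) • (idm (T b) ∘ Tc0))
      · R a b ⊥%ob ⊥%ob · (idm (a • b) ∘ nuD)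
    = (runV (circ D) (T a) • runV (circ D) (T b))
      · (eta T a • eta T b) · run (circ D) (a • b);
  R_onel : forall a b : D,
    ((varpiD · (Tb0 ∘ Tb0)) • idm (T a ∘ T b)) · R 𝟙%ob a 𝟙%ob b
    = lunV (bullet D) (T a ∘ T b)
      · (eta T a ∘ eta T b) · (lun (bullet D) a ∘ lun (bullet D) b);
  R_oner : forall a b : D,
    (idm (T a ∘ T b) • (varpiD · (Tb0 ∘ Tb0))) · R a 𝟙%ob b 𝟙%ob
    = runV (bullet D) (T a ∘ T b)
      · (eta T a ∘ eta T b) · (run (bullet D) a ∘ run (bullet D) b);
  R_act : forall a b c d : D,
    ((mu T a ∘ mu T c) • (mu T b ∘ mu T d))
      · R (T a) (T b) (T c) (T d) · (Tb2 a b ∘ Tb2 c d) · Tc2 (a • b) (c • d)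
    = ((mu T a ∘ mu T c) • (mu T b ∘ mu T d))
      · (Tc2 (T a) (T c) • Tc2 (T b) (T d)) · Tb2 (T a ∘ T c) (T b ∘ T d)
      · fmor T (R a b c d);
  R_circA : forall a b c d x y : D,
    (assoc (circ D) (T a) (T c) (T x) • assoc (circ D) (T b) (T d) (T y))
      · (((mu T a ∘ mu T c) ∘ idm (T x)) • ((mu T b ∘ mu T d) ∘ idm (T y)))
      · ((Tc2 (T a) (T c) ∘ idm (T x)) • (Tc2 (T b) (T d) ∘ idm (T y)))
      · R (T a ∘ T c)%ob (T b ∘ T d)%ob x y · (R a b c d ∘ idm (x • y))
    = ((idm (T a) ∘ (mu T c ∘ mu T x)) • (idm (T b) ∘ (mu T d ∘ mu T y)))
      · ((idm (T a) ∘ Tc2 (T c) (T x)) • (idm (T b) ∘ Tc2 (T d) (T y)))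
      · R a b (T c ∘ T x)%ob (T d ∘ T y)%ob · (idm (a • b) ∘ R c d x y)
      · assoc (circ D) (a • b) (c • d) (x • y);
  R_bulletA : forall x a c y b d : D,
    assoc (bullet D) (T x ∘ T y) (T a ∘ T b) (T c ∘ T d)
      · (((mu T x ∘ mu T y) • (mu T a ∘ mu T b)) • idm (T c ∘ T d))
      · (R (T x) (T a) (T y) (T b) • idm (T c ∘ T d))
      · ((Tb2 x a ∘ Tb2 y b) • idm (T c ∘ T d))
      · R (x • a)%ob c (y • b)%ob d
    = (idm (T x ∘ T y) • ((mu T a ∘ mu T b) • (mu T c ∘ mu T d)))
      · (idm (T x ∘ T y) • R (T a) (T c) (T b) (T d))
      · (idm (T x ∘ T y) • (Tb2 a c ∘ Tb2 b d))
      · R x (a • c)%ob y (b • d)%ob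
      · (assoc (bullet D) x a c ∘ assoc (bullet D) y b d)
}.

Record quasitriangular := Quasitriangular {
  qt_R : forall a b c d : D,
    hom ((a • b) ∘ (c • d)) ((T a ∘ T c) • (T b ∘ T d));
  qt_nu : @hom EM ⊥ (⊥ • ⊥);
  qt_varpi : @hom EM (𝟙 ∘ 𝟙) 𝟙;
  qt_iota : @hom EM ⊥ 𝟙;
  qtP : is_R_matrix qt_R qt_nu qt_varpi qt_iota
}.

End Duoidal.

(* Main.v *)
From mathcomp Require Import ssreflect ssrfun.
From Stdlib Require Import ProofIrrelevance FunctionalExtensionality.
Require Import Defs.

(** The bijection is an instance of transposition along the free-forgetful
    adjunction of T.  For a morphism f : a -> A into the carrier of an algebra,
    let [ext f] : T a -> A be the algebra morphism extending it.  A family R on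
    objects of the base category and a family xi on algebras are mates when
    [[
      ((ext f ∘ ext h) • (ext g ∘ ext k)) · R = xi · ((f • g) ∘ (h • k))
    ]]
    for all f, g, h, k.  Two choices of these morphisms recover the two formulas
    of the theorem: with identities, [ext f] is the action and xi is read off
    from R ([mate_act]); with f = eta into the free algebra, [ext f] is the
    identity and R is read off from xi ([mate_free]).  Hence mates determine
    each other.  A natural R has a mate by naturality ([mates_of_R]); so does a
    xi natural in algebra morphisms, because each [ext f] is one
    ([mates_of_duoidal]).

    It remains to match the axioms.  The R-matrix axioms are the transposes of
    the axioms on xi: composing either side of an R-matrix axiom with
    extensions gives the corresponding side of the axiom on xi, precomposed
    with f, g, ... (the lemmas [mate_*_lhs] and [mate_*_rhs]).  What makes the
    calculation close up is that extension is compatible with the tensor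
    products of algebras ([ext_tensor]) and that precomposing [ext f] with mu
    extends [ext f] once more ([ext_mu]): the factors mu and T_2 in the R-matrix
    axioms are what turn tensor products of extensions into extensions to the
    tensor product algebras at which xi is evaluated, so that the mate relation applies again.
    Identities then give the axioms for xi from those for R, and eta gives the
    converse.  Compatibility of R with the oplax structure ([R_act]) is in this
    way the transpose of xi being a morphism of algebras; the monoid and
    comonoid axioms are common to both structures. *)

Set Implicit Arguments.
Unset Strict Implicit.
Unset Printing Implicit Defensive.

(** * Extension to algebra morphisms *)

Section Extension.
Variables (C : category) (T : monad C).

(** The transpose of [f] along the free-forgetful adjunction.  The lock keeps
    rewriting by associativity from unfolding [ext] and reassociating inside. *)
Definition ext (A : algebra T) (a : C) (f : hom a (carrier A)) :
  hom (T a) (carrier A) := locked (act A · fmor T f).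

Lemma extE (A : algebra T) a (f : hom a (carrier A)) :
  ext f = act A · fmor T f.
Proof. by rewrite /ext -lock. Qed.

Lemma ext_eta (A : algebra T) a (f : hom a (carrier A)) : ext f · eta T a = f.
Proof. by rewrite extE -compA -eta_nat compA act_eta comp1m. Qed.

Lemma ext_id (A : algebra T) : ext (idm (carrier A)) = act A.
Proof. by rewrite extE fmor1 compm1. Qed.

Lemma ext_free a : @ext (free_algebra T a) a (eta T a) = idm (T a).
Proof. by rewrite extE mu_Teta. Qed.

Lemma ext_fmor (A : algebra T) a b (f : hom b (carrier A)) (h : hom a b) :
  ext f · fmor T h = ext (f · h).
Proof. by rewrite !extE fmorM compA. Qed.

(** [ext f] is a morphism of algebras from the free algebra on [a]. *)
Lemma ext_mu (A : algebra T) a (f : hom a (carrier A)) :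
  ext f · mu T a = ext (ext f).
Proof. by rewrite !extE -compA -mu_nat fmorM !compA act_mu. Qed.

Definition ext_hom (A : algebra T) a (f : hom a (carrier A)) :
  alg_hom (free_algebra T a) A :=
  @AlgHom C T (free_algebra T a) A (ext f) (etrans (ext_mu f) (extE (ext f))).

Variables (M : monoidal C) (P : opmonoidal M T).

(** Both sides are the algebra morphism determined by [tmor M f g]; this is how
    the oplax structure maps of T get absorbed in the calculations below. *)
Lemma ext_tensor (A B : algebra T) a b (f : hom a (carrier A))
    (g : hom b (carrier B)) :
  @ext (em_tensor P A B) _ (tmor M f g) = tmor M (ext f) (ext g) · op2 P a b.
Proof. by rewrite !extE /= -compA op2_nat compA -tmorM. Qed.

Lemma ext_unit : @ext (em_unit P) _ (idm (tunit M)) = op0 P.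
Proof. exact: (ext_id (em_unit P)). Qed.

End Extension.
Arguments ext_tensor {C T M} P A B {a b} f g.

(** * Naturality of inverse unitors *)

Section Whiskering.
Variables (C : category) (M : monoidal C).

Lemma lunV_nat a b (f : hom a b) :
  tmor M (idm _) f · lunV M a = lunV M b · f.
Proof.
by rewrite -[LHS]comp1m -(lunK M) -compA (compA (lun M b)) lun_nat -compA lunVK
  compm1.
Qed.

Lemma runV_nat a b (f : hom a b) :
  tmor M f (idm _) · runV M a = runV M b · f.
Proof.
by rewrite -[LHS]comp1m -(runK M) -compA (compA (run M b)) run_nat -compA runVK
  compm1.
Qed.

End Whiskering.

(** * Mates and the transposition of axioms *)

Section Mates.
Variables (D : preduoidal) (T : sep_opmonoidal_monad D).
Local Notation Pc := (som_circ T).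
Local Notation Pb := (som_bullet T).
Local Notation Tc2 := (op2 Pc).
Local Notation Tc0 := (op0 Pc).
Local Notation Tb2 := (op2 Pb).
Local Notation Tb0 := (op0 Pb).
Local Notation F := (free_algebra T).
Local Notation U A := (carrier A).

Definition pre_R_matrix := forall a b c d : D,
  hom ((a • b) ∘ (c • d)) ((T a ∘ T c) • (T b ∘ T d)).

(** Interchange maps on carriers only: that they are morphisms of algebras is
    one of the conditions to be transposed. *)
Definition pre_interchange := forall A B C E : algebra T,
  hom ((U A • U B) ∘ (U C • U E)) ((U A ∘ U C) • (U B ∘ U E)).

Definition mates (R : pre_R_matrix) (xi : pre_interchange) :=
  forall (A B C E : algebra T) (a b c d : D) (f : hom a (U A))
    (g : hom b (U B)) (h : hom c (U C)) (k : hom d (U E)),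
  ((ext f ∘ ext h) • (ext g ∘ ext k)) · R a b c d
  = xi A B C E · ((f • g) ∘ (h • k)).

Section Transposition.
Variables (R : pre_R_matrix) (xi : pre_interchange).
Hypothesis Rxi : mates R xi.

Lemma mate_act A B C E :
  xi A B C E = ((act A ∘ act C) • (act B ∘ act E)) · R (U A) (U B) (U C) (U E).
Proof. by rewrite -!ext_id Rxi !tmor1 compm1. Qed.

Lemma mate_free a b c d :
  R a b c d
  = xi (F a) (F b) (F c) (F d) · ((eta T a • eta T b) ∘ (eta T c • eta T d)).
Proof. by rewrite -Rxi !ext_free !tmor1 comp1m. Qed.

Lemma mate_nat_R a b c d a' b' c' d' (f : hom a a') (g : hom b b')
    (h : hom c c') (k : hom d d') :
  R a' b' c' d' · ((f • g) ∘ (h • k))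
  = ((fmor T f ∘ fmor T h) • (fmor T g ∘ fmor T k)) · R a b c d.
Proof.
have extF x y (l : hom x y) : fmor T l = @ext _ _ (F y) _ (eta T y · l).
  by rewrite -ext_fmor ext_free comp1m.
rewrite !extF (Rxi (A := F a') (B := F b') (C := F c') (E := F d')).
by rewrite !tmorM mate_free compA.
Qed.

(** An algebra morphism composed with an action is an extension, so the mate
    relation already contains naturality. *)
Lemma mate_nat_xi A B C E A' B' C' E' (f : alg_hom A A') (g : alg_hom B B')
    (h : alg_hom C C') (k : alg_hom E E') :
  xi A' B' C' E' · ((alg_mor f • alg_mor g) ∘ (alg_mor h • alg_mor k))
  = ((alg_mor f ∘ alg_mor h) • (alg_mor g ∘ alg_mor k)) · xi A B C E.
Proof. by rewrite -Rxi mate_act compA -!tmorM !alg_morP !extE.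
Qed.

Section Act.
Variables (A B C E : algebra T) (a b c d : D).
Variables (f : hom a (U A)) (g : hom b (U B)) (h : hom c (U C)) (k : hom d (U E)).

(** The mate relation at free objects: mu turns [ext f] into [ext (ext f)]. *)
Lemma mate_mu :
  ((ext f ∘ ext h) • (ext g ∘ ext k)) ·
  ((mu T a ∘ mu T c) • (mu T b ∘ mu T d)) · R (T a) (T b) (T c) (T d)
  = xi A B C E · ((ext f • ext g) ∘ (ext h • ext k)).
Proof. by rewrite -!tmorM !ext_mu Rxi. Qed.

(** This and the next lemma transpose the compatibility of R with the oplax
    structure into the condition that xi be a morphism of algebras.  Here the
    two layers of oplax maps assemble into the action on a tensor product. *)
Lemma mate_act_lhs :
  ((ext f ∘ ext h) • (ext g ∘ ext k)) ·
  (((mu T a ∘ mu T c) • (mu T b ∘ mu T d))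
      · R (T a) (T b) (T c) (T d) · (Tb2 a b ∘ Tb2 c d) · Tc2 (a • b) (c • d))
  = xi A B C E
    · act (em_tensor Pc (em_tensor Pb A B) (em_tensor Pb C E))
    · fmor T ((f • g) ∘ (h • k)).
Proof.
(* [Tb2] and [Tc2] extend along the inner and outer tensor products. *)
have tensorE :
    @ext _ _ (em_tensor Pc (em_tensor Pb A B) (em_tensor Pb C E)) _
      ((f • g) ∘ (h • k))
    = ((ext f • ext g) ∘ (ext h • ext k))
      · (Tb2 a b ∘ Tb2 c d) · Tc2 (a • b) (c • d).
  rewrite (ext_tensor Pc (em_tensor Pb A B) (em_tensor Pb C E)).
  by rewrite !ext_tensor tmorM.
rewrite !compA mate_mu -!compA; congr (_ · _).
by rewrite [LHS]compA -tensorE extE /= !compA.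
Qed.

Lemma mate_act_rhs :
  ((ext f ∘ ext h) • (ext g ∘ ext k)) ·
  (((mu T a ∘ mu T c) • (mu T b ∘ mu T d))
      · (Tc2 (T a) (T c) • Tc2 (T b) (T d)) · Tb2 (T a ∘ T c) (T b ∘ T d)
      · fmor T (R a b c d))
  = act (em_tensor Pb (em_tensor Pc A C) (em_tensor Pc B E))
    · fmor T (xi A B C E) · fmor T ((f • g) ∘ (h • k)).
Proof.
rewrite -[RHS]compA -fmorM -Rxi !compA -!tmorM !ext_mu -!ext_tensor.
rewrite -(ext_tensor Pb (em_tensor Pc A C) (em_tensor Pc B E)).
pose EMt := em_tensor Pb (em_tensor Pc A C) (em_tensor Pc B E).
exact: etrans (ext_fmor (A := EMt) _ _) (extE (A := EMt) _).
Qed.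

End Act.

Section CircA.
Variables (A B C E X Y : algebra T) (a b c d x y : D).
Variables (f : hom a (U A)) (g : hom b (U B)) (h : hom c (U C)) (k : hom d (U E)).
Variables (p : hom x (U X)) (q : hom y (U Y)).

(** The mate relation is used twice: first at the tensor products of the
    algebras A, C and B, E, where [ext f ∘ ext h] plays the role of [f] (its
    extension being supplied by mu and [Tc2]), then at A, B, C, E inside. *)
Lemma mate_circA_lhs :
  ((ext f ∘ (ext h ∘ ext p)) • (ext g ∘ (ext k ∘ ext q)))
  · ((assoc (circ D) (T a) (T c) (T x) • assoc (circ D) (T b) (T d) (T y))
      · (((mu T a ∘ mu T c) ∘ idm (T x)) • ((mu T b ∘ mu T d) ∘ idm (T y)))
      · ((Tc2 (T a) (T c) ∘ idm (T x)) • (Tc2 (T b) (T d) ∘ idm (T y)))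
      · R (T a ∘ T c)%ob (T b ∘ T d)%ob x y · (R a b c d ∘ idm (x • y)))
  = (assoc (circ D) (U A) (U C) (U X) • assoc (circ D) (U B) (U E) (U Y))
    · xi (em_tensor Pc A C) (em_tensor Pc B E) X Y
    · (xi A B C E ∘ idm (U X • U Y))
    · (((f • g) ∘ (h • k)) ∘ (p • q)).
Proof.
rewrite !compA -(tmorM (bullet D)) -!assoc_nat (tmorM (bullet D)) -!compA.
congr (_ · _); rewrite !compA -!tmorM !compm1 !ext_mu -!ext_tensor.
rewrite (Rxi (A := em_tensor Pc A C) (B := em_tensor Pc B E)).
by rewrite -!compA -!tmorM Rxi comp1m compm1.
Qed.

Lemma mate_circA_rhs :
  ((ext f ∘ (ext h ∘ ext p)) • (ext g ∘ (ext k ∘ ext q)))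
  · (((idm (T a) ∘ (mu T c ∘ mu T x)) • (idm (T b) ∘ (mu T d ∘ mu T y)))
      · ((idm (T a) ∘ Tc2 (T c) (T x)) • (idm (T b) ∘ Tc2 (T d) (T y)))
      · R a b (T c ∘ T x)%ob (T d ∘ T y)%ob · (idm (a • b) ∘ R c d x y)
      · assoc (circ D) (a • b) (c • d) (x • y))
  = xi A B (em_tensor Pc C X) (em_tensor Pc E Y)
    · (idm (U A • U B) ∘ xi C E X Y)
    · assoc (circ D) (U A • U B) (U C • U E) (U X • U Y)
    · (((f • g) ∘ (h • k)) ∘ (p • q)).
Proof.
rewrite -!(compA _ (assoc _ _ _ _)) assoc_nat !compA; congr (_ · _).
rewrite -!tmorM !compm1 !ext_mu -!ext_tensor.
rewrite (Rxi (C := em_tensor Pc C X) (E := em_tensor Pc E Y)).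
by rewrite -!compA -!tmorM Rxi comp1m compm1.
Qed.

End CircA.

Section BulletA.
Variables (X A C Y B E : algebra T) (x a c y b d : D).
Variables (p : hom x (U X)) (f : hom a (U A)) (h : hom c (U C)).
Variables (q : hom y (U Y)) (g : hom b (U B)) (k : hom d (U E)).

(** Again two uses of the mate relation, now in the other order: the outer one
    consumes mu and leaves [ext p • ext f], which [Tb2] turns into the extension
    needed for the inner one. *)
Lemma mate_bulletA_lhs :
  ((ext p ∘ ext q) • ((ext f ∘ ext g) • (ext h ∘ ext k)))
  · (assoc (bullet D) (T x ∘ T y) (T a ∘ T b) (T c ∘ T d)
      · (((mu T x ∘ mu T y) • (mu T a ∘ mu T b)) • idm (T c ∘ T d))
      · (R (T x) (T a) (T y) (T b) • idm (T c ∘ T d))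
      · ((Tb2 x a ∘ Tb2 y b) • idm (T c ∘ T d))
      · R (x • a)%ob c (y • b)%ob d)
  = assoc (bullet D) (U X ∘ U Y) (U A ∘ U B) (U C ∘ U E)
    · (xi X A Y B • idm (U C ∘ U E))
    · xi (em_tensor Pb X A) C (em_tensor Pb Y B) E
    · (((p • f) • h) ∘ ((q • g) • k)).
Proof.
rewrite !compA -assoc_nat -!compA; congr (_ · _).
rewrite !compA -!(tmorM (bullet D)) !compm1 -2!(tmorM (circ D)).
rewrite !ext_mu Rxi -(compA (xi _ _ _ _)) -tmorM -!ext_tensor.
(* Leave xi alone on the left, all extensions next to the remaining R. *)
rewrite -[ext h ∘ ext k]comp1m tmorM -compA.
by rewrite (Rxi (A := em_tensor Pb X A) (C := em_tensor Pb Y B)) !compA.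
Qed.

Lemma mate_bulletA_rhs :
  ((ext p ∘ ext q) • ((ext f ∘ ext g) • (ext h ∘ ext k)))
  · ((idm (T x ∘ T y) • ((mu T a ∘ mu T b) • (mu T c ∘ mu T d)))
      · (idm (T x ∘ T y) • R (T a) (T c) (T b) (T d))
      · (idm (T x ∘ T y) • (Tb2 a c ∘ Tb2 b d))
      · R x (a • c)%ob y (b • d)%ob
      · (assoc (bullet D) x a c ∘ assoc (bullet D) y b d))
  = (idm (U X ∘ U Y) • xi A C B E)
    · xi X (em_tensor Pb A C) Y (em_tensor Pb B E)
    · (assoc (bullet D) (U X) (U A) (U C) ∘ assoc (bullet D) (U Y) (U B) (U E))
    · (((p • f) • h) ∘ ((q • g) • k)).
Proof.
rewrite -(compA _ (assoc _ _ _ _ ∘ _)) -(tmorM (circ D)) !assoc_nat.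
rewrite [in RHS]tmorM !compA; congr (_ · _).
rewrite -!(tmorM (bullet D)) !compm1 -2!(tmorM (circ D)).
rewrite !ext_mu Rxi -(compA (xi _ _ _ _)) -tmorM -!ext_tensor.
(* Leave xi alone on the left, all extensions next to the remaining R. *)
rewrite -[ext p ∘ ext q]comp1m tmorM -compA.
by rewrite (Rxi (B := em_tensor Pb A C) (E := em_tensor Pb B E)) !compA.
Qed.

End BulletA.

Section Units.
Variables (A B : algebra T) (a b : D) (f : hom a (U A)) (g : hom b (U B)).
Variables (nu : @hom D ⊥ (⊥ • ⊥)) (varpi : @hom D (𝟙 ∘ 𝟙) 𝟙).
Local Notation bot := (em_unit Pc).
Local Notation one := (em_unit Pb).

(** The counits [Tc0] and [Tb0] are the actions of the unit algebras, hence the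
    extensions of identities: this is what allows the mate relation to be used
    at the unit algebras in the unit axioms. *)
Lemma mate_botl_lhs :
  ((idm ⊥ ∘ ext f) • (idm ⊥ ∘ ext g))
  · (((Tc0 ∘ idm (T a)) • (Tc0 ∘ idm (T b)))
      · R ⊥%ob ⊥%ob a b · (nu ∘ idm (a • b)))
  = xi bot bot A B · (nu ∘ idm (U A • U B)) · (idm ⊥ ∘ (f • g)).
Proof.
rewrite !compA -!tmorM !comp1m !compm1 -ext_unit.
rewrite (Rxi (A := bot) (B := bot)).
by rewrite -!compA -!tmorM tmor1 !comp1m !compm1.
Qed.

Lemma mate_botl_rhs :
  ((idm ⊥ ∘ ext f) • (idm ⊥ ∘ ext g))
  · ((lunV (circ D) (T a) • lunV (circ D) (T b))
      · (eta T a • eta T b) · lun (circ D) (a • b))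
  = (lunV (circ D) (U A) • lunV (circ D) (U B)) · lun (circ D) (U A • U B)
    · (idm ⊥ ∘ (f • g)).
Proof.
rewrite -(compA _ (lun _ _)) lun_nat !compA; congr (_ · _).
by rewrite -!tmorM !lunV_nat -!compA !ext_eta.
Qed.

Lemma mate_botr_lhs :
  ((ext f ∘ idm ⊥) • (ext g ∘ idm ⊥))
  · (((idm (T a) ∘ Tc0) • (idm (T b) ∘ Tc0))
      · R a b ⊥%ob ⊥%ob · (idm (a • b) ∘ nu))
  = xi A B bot bot · (idm (U A • U B) ∘ nu) · ((f • g) ∘ idm ⊥).
Proof.
rewrite !compA -!tmorM !comp1m !compm1 -ext_unit.
rewrite (Rxi (C := bot) (E := bot)).
by rewrite -!compA -!tmorM tmor1 !comp1m !compm1.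
Qed.

Lemma mate_botr_rhs :
  ((ext f ∘ idm ⊥) • (ext g ∘ idm ⊥))
  · ((runV (circ D) (T a) • runV (circ D) (T b))
      · (eta T a • eta T b) · run (circ D) (a • b))
  = (runV (circ D) (U A) • runV (circ D) (U B)) · run (circ D) (U A • U B)
    · ((f • g) ∘ idm ⊥).
Proof.
rewrite -(compA _ (run _ _)) run_nat !compA; congr (_ · _).
by rewrite -!tmorM !runV_nat -!compA !ext_eta.
Qed.

Lemma mate_onel_lhs :
  (idm 𝟙 • (ext f ∘ ext g))
  · (((varpi · (Tb0 ∘ Tb0)) • idm (T a ∘ T b)) · R 𝟙%ob a 𝟙%ob b)
  = (varpi • idm (U A ∘ U B)) · xi one A one B
    · ((idm 𝟙 • f) ∘ (idm 𝟙 • g)).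
Proof.
rewrite -compA -Rxi !ext_unit !compA -!(tmorM (bullet D)).
by rewrite !comp1m compm1.
Qed.

Lemma mate_onel_rhs :
  (idm 𝟙 • (ext f ∘ ext g))
  · (lunV (bullet D) (T a ∘ T b)
      · (eta T a ∘ eta T b) · (lun (bullet D) a ∘ lun (bullet D) b))
  = lunV (bullet D) (U A ∘ U B) · (lun (bullet D) (U A) ∘ lun (bullet D) (U B))
    · ((idm 𝟙 • f) ∘ (idm 𝟙 • g)).
Proof.
by rewrite !compA lunV_nat -!compA -!tmorM !lun_nat !compA !ext_eta.
Qed.

Lemma mate_oner_lhs :
  ((ext f ∘ ext g) • idm 𝟙)
  · ((idm (T a ∘ T b) • (varpi · (Tb0 ∘ Tb0))) · R a 𝟙%ob b 𝟙%ob)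
  = (idm (U A ∘ U B) • varpi) · xi A one B one
    · ((f • idm 𝟙) ∘ (g • idm 𝟙)).
Proof.
rewrite -compA -Rxi !ext_unit !compA -!(tmorM (bullet D)).
by rewrite !comp1m compm1.
Qed.

Lemma mate_oner_rhs :
  ((ext f ∘ ext g) • idm 𝟙)
  · (runV (bullet D) (T a ∘ T b)
      · (eta T a ∘ eta T b) · (run (bullet D) a ∘ run (bullet D) b))
  = runV (bullet D) (U A ∘ U B) · (run (bullet D) (U A) ∘ run (bullet D) (U B))
    · ((f • idm 𝟙) ∘ (g • idm 𝟙)).
Proof.
by rewrite !compA runV_nat -!compA -!tmorM !run_nat !compA !ext_eta.
Qed.

End Units.
End Transposition.
End Mates.

(** * The two constructions *)

Section Bijection.
Variables (D : preduoidal) (T : sep_opmonoidal_monad D).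
Local Notation F := (free_algebra T).
Local Notation U A := (carrier A).

Lemma quasitriangular_eq (Q Q' : quasitriangular T) :
  (forall a b c d, qt_R Q a b c d = qt_R Q' a b c d) ->
  qt_nu Q = qt_nu Q' -> qt_varpi Q = qt_varpi Q' -> qt_iota Q = qt_iota Q' ->
  Q = Q'.
Proof.
case: Q Q' => [R nu w i p] [R' nu' w' i' p'] /= eR; move: p p'.
have -> : R = R' by do 4!apply: functional_extensionality_dep => ?; exact: eR.
move=> p p' *; subst; congr (Quasitriangular _); exact: proof_irrelevance.
Qed.

Lemma duoidal_eq (E : preduoidal) (X X' : duoidal E) :
  (forall A B C B', duo_zeta X A B C B' = duo_zeta X' A B C B') ->
  duo_nu X = duo_nu X' -> duo_varpi X = duo_varpi X' ->
  duo_iota X = duo_iota X' -> X = X'.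
Proof.
case: X X' => [R nu w i p] [R' nu' w' i' p'] /= eR; move: p p'.
have -> : R = R' by do 4!apply: functional_extensionality_dep => ?; exact: eR.
move=> p p' *; subst; congr (Duoidal _); exact: proof_irrelevance.
Qed.

Section FromRMatrix.
Variable Q : quasitriangular T.
Local Notation R := (qt_R Q).

Definition xi_of_R : pre_interchange T := fun A B C E =>
  ((act A ∘ act C) • (act B ∘ act E)) · R (U A) (U B) (U C) (U E).

Lemma mates_of_R : mates R xi_of_R.
Proof.
move=> A B C E a b c d f g h k.
by rewrite !extE !tmorM -compA -(R_nat (qtP Q)) compA.
Qed.

(** The compatibility axiom for R, transposed at identities. *)
Lemma xi_of_R_alg A B C E :
  xi_of_R A B C E
    · act (em_tensor (som_circ T) (em_tensor (som_bullet T) A B)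
             (em_tensor (som_bullet T) C E))
  = act (em_tensor (som_bullet T) (em_tensor (som_circ T) A C)
           (em_tensor (som_circ T) B E))
    · fmor T (xi_of_R A B C E).
Proof.
have := mate_act_lhs mates_of_R (idm (U A)) (idm (U B)) (idm (U C)) (idm (U E)).
rewrite (R_act (qtP Q)) (mate_act_rhs mates_of_R).
by rewrite !tmor1 fmor1 !compm1 => ->.
Qed.

Definition zeta_of_R (A B C E : EM T) :
  @hom (EM T) ((A • B) ∘ (C • E)) ((A ∘ C) • (B ∘ E)) :=
  @AlgHom _ T ((A • B) ∘ (C • E))%ob ((A ∘ C) • (B ∘ E))%ob _
    (xi_of_R_alg A B C E).

(** Transposition at identities, whose extensions are the actions, leaves on
    one side just the axiom for xi. *)
Lemma zeta_of_R_duoidal :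
  is_duoidal zeta_of_R (qt_nu Q) (qt_varpi Q) (qt_iota Q).
Proof.
have RP := qtP Q; have Rxi := mates_of_R.
split; [exact: R_monoid RP | exact: R_comonoid RP | ..].
- by move=> *; apply: alg_hom_eq; exact: mate_nat_xi.
- move=> A B C E X Y; apply: alg_hom_eq => /=.
  have := mate_circA_lhs Rxi (idm (U A)) (idm (U B)) (idm (U C)) (idm (U E))
            (idm (U X)) (idm (U Y)).
  by rewrite (R_circA RP) (mate_circA_rhs Rxi) !tmor1 !compm1 => ->.
- move=> X A C Y B E; apply: alg_hom_eq => /=.
  have := mate_bulletA_lhs Rxi (idm (U X)) (idm (U A)) (idm (U C)) (idm (U Y))
            (idm (U B)) (idm (U E)).
  by rewrite (R_bulletA RP) (mate_bulletA_rhs Rxi) !tmor1 !compm1 => ->.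
- move=> A B; apply: alg_hom_eq => /=.
  have := mate_botl_lhs Rxi (idm (U A)) (idm (U B)) (alg_mor (qt_nu Q)).
  by rewrite (R_botl RP) mate_botl_rhs !tmor1 !compm1 => ->.
- move=> A B; apply: alg_hom_eq => /=.
  have := mate_botr_lhs Rxi (idm (U A)) (idm (U B)) (alg_mor (qt_nu Q)).
  by rewrite (R_botr RP) mate_botr_rhs !tmor1 !compm1 => ->.
- move=> A B; apply: alg_hom_eq => /=.
  have := mate_onel_lhs Rxi (idm (U A)) (idm (U B)) (alg_mor (qt_varpi Q)).
  by rewrite (R_onel RP) mate_onel_rhs !tmor1 !compm1 => ->.
- move=> A B; apply: alg_hom_eq => /=.
  have := mate_oner_lhs Rxi (idm (U A)) (idm (U B)) (alg_mor (qt_varpi Q)).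
  by rewrite (R_oner RP) mate_oner_rhs !tmor1 !compm1 => ->.
Qed.

Definition duoidal_of_R : duoidal (EM T) := Duoidal zeta_of_R_duoidal.

End FromRMatrix.

Section FromInterchange.
Variable X : duoidal (EM T).

Definition xi_of_duoidal : pre_interchange T := fun A B C E =>
  alg_mor (duo_zeta X A B C E).
Local Notation xi := xi_of_duoidal.

Definition R_of_duoidal : pre_R_matrix T := fun a b c d =>
  xi (F a) (F b) (F c) (F d) · ((eta T a • eta T b) ∘ (eta T c • eta T d)).
Local Notation R := R_of_duoidal.

(** Naturality of xi along the algebra morphisms [ext f], restricted along
    eta. *)
Lemma mates_of_duoidal : mates R xi.
Proof.
move=> A B C E a b c d f g h k.
have := congr1 (@alg_mor _ _ _ _)
  (zeta_nat (duoP X) (ext_hom f) (ext_hom g) (ext_hom h) (ext_hom k)).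
rewrite /= /R_of_duoidal compA => <-.
by rewrite -compA -!tmorM !ext_eta.
Qed.

(** Transposition at the units eta, whose extensions are identities, leaves on
    one side just the R-matrix axiom; the axiom for xi is used at free
    algebras. *)
Lemma R_of_duoidal_R_matrix :
  is_R_matrix R (duo_nu X) (duo_varpi X) (duo_iota X).
Proof.
have XP := duoP X; have Rxi := mates_of_duoidal.
split; [exact: duo_monoid XP | exact: duo_comonoid XP | ..].
- exact: mate_nat_R Rxi.
- move=> a b.
  have := mate_botl_lhs (A := F a) (B := F b) Rxi (eta T a) (eta T b)
            (alg_mor (duo_nu X)).
  have := mate_botl_rhs (A := F a) (B := F b) (eta T a) (eta T b).
  have := congr1 (@alg_mor _ _ _ _) (zeta_botl XP (F a) (F b)).
  by rewrite /= !ext_free !tmor1 !comp1m => -> -> ->.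
- move=> a b.
  have := mate_botr_lhs (A := F a) (B := F b) Rxi (eta T a) (eta T b)
            (alg_mor (duo_nu X)).
  have := mate_botr_rhs (A := F a) (B := F b) (eta T a) (eta T b).
  have := congr1 (@alg_mor _ _ _ _) (zeta_botr XP (F a) (F b)).
  by rewrite /= !ext_free !tmor1 !comp1m => -> -> ->.
- move=> a b.
  have := mate_onel_lhs (A := F a) (B := F b) Rxi (eta T a) (eta T b)
            (alg_mor (duo_varpi X)).
  have := mate_onel_rhs (A := F a) (B := F b) (eta T a) (eta T b).
  have := congr1 (@alg_mor _ _ _ _) (zeta_onel XP (F a) (F b)).
  by rewrite /= !ext_free !tmor1 !comp1m => -> -> ->.
- move=> a b.
  have := mate_oner_lhs (A := F a) (B := F b) Rxi (eta T a) (eta T b)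
            (alg_mor (duo_varpi X)).
  have := mate_oner_rhs (A := F a) (B := F b) (eta T a) (eta T b).
  have := congr1 (@alg_mor _ _ _ _) (zeta_oner XP (F a) (F b)).
  by rewrite /= !ext_free !tmor1 !comp1m => -> -> ->.
- move=> a b c d.
  have := mate_act_lhs (A := F a) (B := F b) (C := F c) (E := F d) Rxi
            (eta T a) (eta T b) (eta T c) (eta T d).
  rewrite (alg_morP (duo_zeta X _ _ _ _)) -(mate_act_rhs Rxi).
  by rewrite !ext_free !tmor1 !comp1m.
- move=> a b c d x y.
  have := mate_circA_lhs (A := F a) (B := F b) (C := F c) (E := F d) (X := F x)
    (Y := F y) Rxi (eta T a) (eta T b) (eta T c) (eta T d) (eta T x) (eta T y).
  have := mate_circA_rhs (A := F a) (B := F b) (C := F c) (E := F d) (X := F x)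
    (Y := F y) Rxi (eta T a) (eta T b) (eta T c) (eta T d) (eta T x) (eta T y).
  have := congr1 (@alg_mor _ _ _ _)
    (zeta_circA XP (F a) (F b) (F c) (F d) (F x) (F y)).
  by rewrite /= !ext_free !tmor1 !comp1m => -> -> ->.
- move=> x a c y b d.
  have := mate_bulletA_lhs (X := F x) (A := F a) (C := F c) (Y := F y) (B := F b)
    (E := F d) Rxi (eta T x) (eta T a) (eta T c) (eta T y) (eta T b) (eta T d).
  have := mate_bulletA_rhs (X := F x) (A := F a) (C := F c) (Y := F y) (B := F b)
    (E := F d) Rxi (eta T x) (eta T a) (eta T c) (eta T y) (eta T b) (eta T d).
  have := congr1 (@alg_mor _ _ _ _)
    (zeta_bulletA XP (F x) (F a) (F c) (F y) (F b) (F d)).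
  by rewrite /= !ext_free !tmor1 !comp1m => -> -> ->.
Qed.

Definition R_matrix_of_duoidal : quasitriangular T :=
  Quasitriangular R_of_duoidal_R_matrix.

End FromInterchange.
End Bijection.

Theorem theorem7p21 (D : preduoidal) (T : sep_opmonoidal_monad D) :
  exists (to_duoidal : quasitriangular T -> duoidal (EM T))
         (to_quasitriangular : duoidal (EM T) -> quasitriangular T),
    (forall Q : quasitriangular T,
       (forall A B C E : algebra T,
          alg_mor (duo_zeta (to_duoidal Q) A B C E)
          = ((act A ∘ act C) • (act B ∘ act E))
            · qt_R Q (carrier A) (carrier B) (carrier C) (carrier E)) /\
       duo_nu (to_duoidal Q) = qt_nu Q /\
       duo_varpi (to_duoidal Q) = qt_varpi Q /\
       duo_iota (to_duoidal Q) = qt_iota Q) /\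
    (forall X : duoidal (EM T),
       (forall a b c d : D,
          qt_R (to_quasitriangular X) a b c d
          = alg_mor (duo_zeta X (free_algebra T a) (free_algebra T b)
                                (free_algebra T c) (free_algebra T d))
            · ((eta T a • eta T b) ∘ (eta T c • eta T d))) /\
       qt_nu (to_quasitriangular X) = duo_nu X /\
       qt_varpi (to_quasitriangular X) = duo_varpi X /\
       qt_iota (to_quasitriangular X) = duo_iota X) /\
    cancel to_duoidal to_quasitriangular /\
    cancel to_quasitriangular to_duoidal.
Proof.
exists (@duoidal_of_R D T), (@R_matrix_of_duoidal D T).
do 3!split=> //.
- move=> Q; apply: quasitriangular_eq => //= a b c d.
  exact: esym (mate_free (mates_of_R Q) a b c d).
- move=> X; apply: duoidal_eq => //= A B C E; apply: alg_hom_eq.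
  exact: esym (mate_act (mates_of_duoidal X) A B C E).
Qed.
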